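(* Let $X=(X,d_X,\mu_X)$ be an mm space and let $\mathfrak{Y}$ be a family of metric spaces which is a Lipschitz-approximated family to $X$. (1) Assume that compact metric spaces $Y_n$ $(n\in\mathbb{N})$ and $Y$ in $\mathfrak{Y}$ satisfy $Y_n\to Y$ in the Gromov-Hausdorff sense. Then $$\mathrm{ObsDiam}_Y(X;-\kappa)=\lim_{n\to\infty}\mathrm{ObsDiam}_{Y_n}(X;-\kappa)$$ for Lebesgue-a.e. $\kappa\in(0,1)$. (2) Assume that noncompact metric spaces $Y_n$ $(n\in\mathbb{N})$ and $Y$ in $\mathfrak{Y}$ satisfy $(Y_n,o_n)\to(Y,o)$ in the pointed Gromov-Hausdorff sense for some points $o_n\in Y_n$, $o\in Y$. Then $$\mathrm{ObsDiam}_Y(X;-\kappa)\le\liminf_{n\to\infty}\mathrm{ObsDiam}_{Y_n}(X;-\kappa)$$ for Lebesgue-a.e. $\kappa\in(0,1)$.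
   Context: An mm space is a triple $X=(X,d_X,\mu_X)$ with $(X,d_X)$ a complete separable metric space and $\mu_X$ a Borel probability measure; it is always assumed that $\mathrm{supp}\,\mu_X=X$. Partial diameter: for a Borel probability measure $\mu$ on a metric space $Z$ and $\kappa>0$, $\mathrm{Diam}(\mu;1-\kappa):=\inf\{\mathrm{Diam}(A): A\subset Z \text{ Borel},\ \mu(A)\ge 1-\kappa\}$. Observable diameter with screen $Y$: for a metric space $Y$ and $\kappa>0$, $\mathrm{ObsDiam}_Y(X;-\kappa):=\sup\{\mathrm{Diam}(f_\#\mu_X;1-\kappa): f\in \mathrm{Lip}_1(X,Y)\}$, where $\mathrm{Lip}_1(X,Y)$ is the set of all 1-Lipschitz maps $X\to Y$ and $f_\#\mu_X$ is the push-forward measure. For $\delta>0$, $\widetilde{\mathrm{Lip}_1^{\delta}}(X,Y)$ is the set of Borel measurable maps $f:X\to Y$ for which there is a Borel subset $\widetilde X\subset X$ with $\mu_X(\widetilde X)\ge 1-\delta$ and $d_Y(f(z_1),f(z_2))\le d_X(z_1,z_2)+\delta$ for all $z_1,z_2\in\widetilde X$. Ky Fan distance: for Borel maps $f,g:X\to Y$, $d_{KF}^{\mu_X}(f,g):=\inf\{\varepsilon\ge 0:\mu_X(\{z: d_Y(f(z),g(z))>\varepsilon\})\le\varepsilon\}$ (with $\mu_X$ read as outer measure if the set is not measurable, which cannot occur for separable $Y$). For sets $A,B$ of such maps, $Hd_{KF}^{\mu_X}(A,B)$ is the Hausdorff distance: the infimum of $\varepsilon>0$ such that the open $\varepsilon$-neighborhood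 (with respect to $d_{KF}^{\mu_X}$) of $A$ contains $B$ and that of $B$ contains $A$. A family of metric spaces $\mathfrak{Y}$ is a Lipschitz-approximated family to $X$ if $\lim_{\delta\to+0}\sup_{Y\in\mathfrak{Y}}Hd_{KF}^{\mu_X}(\mathrm{Lip}_1(X,Y),\widetilde{\mathrm{Lip}_1^{\delta}}(X,Y))=0$. Gromov-Hausdorff convergence of compact metric spaces is convergence with respect to the usual Gromov-Hausdorff distance. Pointed Gromov-Hausdorff convergence: for proper pointed metric spaces $(Y_n,o_n)$, $(Y,o)$, one says $(Y_n,o_n)\to(Y,o)$ if there are numbers $R_n\uparrow\infty$, $\varepsilon_n\downarrow0$ and Borel measurable maps $f_n:B_{R_n}(o)\to Y_n$ such that $|d_{Y_n}(f_n(z_1),f_n(z_2))-d_Y(z_1,z_2)|<\varepsilon_n$ for all $z_1,z_2\in B_{R_n}(o)$, and $U_{\varepsilon_n}(f_n(B_{R_n}(o)))\supset B_{R_n-\varepsilon_n}(o_n)$. Here $B_r$ denotes the closed $r$-ball and $U_\varepsilon(A)$ the open $\varepsilon$-neighborhood of a set $A$. In particular, the spaces in any pointed Gromov-Hausdorff convergence statement are understood to be proper. *)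

(* Defs.v *)
From HB Require Import structures.
From mathcomp Require Import all_boot all_order all_algebra.
From mathcomp Require Import all_classical all_reals all_analysis.

Set Implicit Arguments.
Unset Strict Implicit.
Unset Printing Implicit Defensive.

Import Order.TTheory GRing.Theory Num.Theory.
Import numFieldNormedType.Exports.

Local Open Scope classical_set_scope.
Local Open Scope ring_scope.

(* Nonempty metric spaces: [g_sigma_algebraType] is a measurable type only over
   a [pointedType].  The distinguished element [point] plays no other role; it
   is unrelated to base points in pointed Gromov-Hausdorff convergence. *)
#[short(type="pmetricType")]
HB.structure Definition PointedMetric (K : numDomainType) :=
  {M of Metric K M & isPointed M}.

Notation borel T := (g_sigma_algebraType (@open T)).

Section metric_spaces.
Context {R : realType}.

(* This is the axiom [cauchy_cvg] of the library's [completeType]. *)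
Definition complete_space (X : pmetricType R) : Prop :=
  forall F : set_system X, ProperFilter F -> cauchy F -> cvg F.

Definition separable_space (X : pmetricType R) : Prop :=
  exists2 D : set X, countable D & dense D.

(* [closed_ball] in the library is the closure of the open ball, which may be
   strictly smaller than this set. *)
Definition cball (X : pmetricType R) (x : X) (r : R) : set X :=
  [set y | mdist x y <= r].

Definition nbhd_of (X : pmetricType R) (A : set X) (e : R) : set X :=
  [set y | exists2 x, A x & mdist x y < e].

Definition proper_space (X : pmetricType R) : Prop :=
  forall (x : X) (r : R), compact (cball x r).

(* The element 0 only serves to give the empty set diameter 0. *)
Definition diam (X : pmetricType R) (A : set X) : \bar R :=
  ereal_sup (0%E |` [set (mdist x y)%:E | x in A & y in A]).

Definition lip1 (X Y : pmetricType R) : set (X -> Y) :=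
  [set f | forall x y, mdist (f x) (f y) <= mdist x y].

Definition isometric_embedding (X Y : pmetricType R) (f : X -> Y) : Prop :=
  forall x y, mdist (f x) (f y) = mdist x y.

End metric_spaces.
Arguments lip1 {R} X Y.

(* The distance [d] is a parameter because the notion is used both for subsets
   of a metric space and for sets of maps with the Ky Fan distance. *)
Definition hausdorff_dist {R : realType} (T : Type) (d : T -> T -> \bar R)
    (A B : set T) : \bar R :=
  ereal_inf [set e%:E | e in [set e : R |
    [/\ 0 < e,
        forall b, B b -> exists2 a, A a & (d a b < e%:E)%E &
        forall a, A a -> exists2 b, B b & (d b a < e%:E)%E]]].

Section mm_spaces.
Context {R : realType}.

Definition msupport (X : pmetricType R) (mu : set (borel X) -> \bar R) :
    set X :=
  [set x | forall U : set X, open U -> U x -> (0 < mu U)%E].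

Definition mm_space (X : pmetricType R) (mu : probability (borel X) R) : Prop :=
  [/\ complete_space X, separable_space X & msupport mu = [set: X]].

Definition partial_diam (Z : pmetricType R) (m : set (borel Z) -> \bar R)
    (a : R) : \bar R :=
  ereal_inf [set diam (A : set Z) | A in [set A : set (borel Z) |
    measurable A /\ (a%:E <= m A)%E]].

Definition obs_diam (X : pmetricType R) (mu : probability (borel X) R)
    (Y : pmetricType R) (kappa : R) : \bar R :=
  ereal_sup [set partial_diam
      (pushforward mu (f : borel X -> borel Y)) (1 - kappa) | f in lip1 X Y].

Definition lip1_approx (X : pmetricType R) (mu : probability (borel X) R)
    (Y : pmetricType R) (delta : R) : set (X -> Y) :=
  [set f | measurable_fun [set: borel X] (f : borel X -> borel Y) /\
    exists X' : set (borel X),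
      [/\ measurable X', ((1 - delta)%:E <= mu X')%E &
          forall z1 z2 : X, X' z1 -> X' z2 ->
            mdist (f z1) (f z2) <= mdist z1 z2 + delta]].

(* [mu^*] is the outer measure of [mu]; it agrees with [mu] on Borel sets. *)
Definition ky_fan (X : pmetricType R) (mu : probability (borel X) R)
    (Y : pmetricType R) (f g : X -> Y) : \bar R :=
  ereal_inf [set e%:E | e in [set e : R | 0 <= e /\
    ((mu^*)%mu [set z : borel X | (e < mdist (f z) (g z))%R] <= e%:E)%E]].

Definition lipschitz_approximated (X : pmetricType R)
    (mu : probability (borel X) R) (fam : set (pmetricType R)) : Prop :=
  ereal_sup [set hausdorff_dist (ky_fan mu (Y:=Y))
                   (lip1 X Y) (@lip1_approx X mu Y delta) | Y in fam]
    @[delta --> (0 : R)^'+] --> 0%E.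

End mm_spaces.

Section gromov_hausdorff.
Context {R : realType}.

Definition gh_dist (X Y : pmetricType R) : \bar R :=
  ereal_inf [set r | exists (Z : pmetricType R) (i : X -> Z) (j : Y -> Z),
    [/\ isometric_embedding i, isometric_embedding j &
        r = hausdorff_dist (fun x y : Z => (mdist x y)%:E)
              (range i) (range j)]].

Definition gh_cvg (Y_ : nat -> pmetricType R) (Y : pmetricType R) : Prop :=
  gh_dist (Y_ n) Y @[n --> \oo] --> 0%E.

(* A map on the ball is encoded as a map on all of [Y], constrained on the ball
   only; no generality is lost as [Y_ n] is nonempty. *)
Definition pointed_gh_cvg (Y_ : nat -> pmetricType R) (o_ : forall n, Y_ n)
    (Y : pmetricType R) (o : Y) : Prop :=
  exists (r e : nat -> R) (f : forall n, Y -> Y_ n),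
    [/\ nondecreasing_seq r, r n @[n --> \oo] --> +oo,
        nonincreasing_seq e, e n @[n --> \oo] --> (0 : R) &
        forall n,
        [/\ measurable_fun (cball o (r n) : set (borel Y))
              (f n : borel Y -> borel (Y_ n)),
            forall z1 z2, cball o (r n) z1 -> cball o (r n) z2 ->
              `|mdist (f n z1) (f n z2) - mdist z1 z2| < e n &
            cball (o_ n) (r n - e n) `<=`
              nbhd_of (f n @` cball o (r n)) (e n)]].

End gromov_hausdorff.

(* Main.v *)
Require Import Defs.
From HB Require Import structures.
From mathcomp Require Import all_boot all_order all_algebra.
From mathcomp Require Import all_classical all_reals all_analysis.
From mathcomp Require Import finmap lra.

Set Implicit Arguments.
Unset Strict Implicit.
Unset Printing Implicit Defensive.

Import Order.TTheory GRing.Theory Num.Theory.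
Import numFieldNormedType.Exports.

Local Open Scope classical_set_scope.
Local Open Scope ring_scope.

(** The function k |-> ObsDiam_Y(X; -k) is nonincreasing, hence continuous for
all k outside a countable set, which is Lebesgue-negligible
([nonincreasing_ae_continuous]).  At a continuity point it is enough to compare
the observable diameters of Y and Y_n up to an arbitrarily small shift of k and
an arbitrarily small additive error.

Such a comparison comes from transporting maps.  Let f : X -> Y be 1-Lipschitz
and let h : X -> Z be a Borel map which, outside a set of measure at most d,
distorts the distances between values of f by at most d
([almost_isometric_copy]).  Then h is 1-Lipschitz up to d, so for d small the
Lipschitz approximation property provides a genuine 1-Lipschitz map g : X -> Z
that is Ky Fan close to h; the choice of d depends neither on Z nor on f.  If g
has a set of values of diameter D with mass at least 1 - k, then intersecting
with the events on which h copies f and g is close to h gives a set of values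
of f of diameter at most D + e with mass at least 1 - (k + e)
([partial_diam_copy], [lipschitz_approximated_transfer]).

It remains to produce the copies.  If Y_n and Y are compact and
Gromov-Hausdorff close, there are maps in both directions which nearly preserve
distances; they become Borel after precomposition with a countably valued Borel
map near the identity ([compact_quantization]), so copies exist for all f at
once and in both directions ([compact_copy]); this bounds both limits.  In the
pointed case the maps given by the convergence are defined on balls of radius
tending to infinity, whose preimages under a fixed f exhaust X, so they yield
copies of each single f for large n ([pointed_copy]); since the observable
diameter of Y is a supremum over f, this suffices for the lower limit. *)

(** * Monotone extended-real functions and limits *)

Section ereal_monotone.
Context {R : realType}.
Local Open Scope ereal_scope.

Lemma ereal_rat_between (a b : \bar R) :
  a < b -> exists q : rat, a < (ratr q)%:E < b.
Proof.
move: a b => [a| |] [b| |]//; rewrite ?lte_fin => ab.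
- have [q] := rat_in_itvoo ab; rewrite in_itv/= => /andP[aq qb].
  by exists q; rewrite !lte_fin aq.
- have [q] := @rat_in_itvoo R a (a + 1)%R ltac:(by rewrite ltrDl).
  by rewrite in_itv/= => /andP[aq qb]; exists q; rewrite lte_fin aq ltry.
- have [q] := @rat_in_itvoo R (b - 1)%R b ltac:(by rewrite ltrBlDr ltrDl).
  by rewrite in_itv/= => /andP[aq qb]; exists q; rewrite lte_fin qb ltNyr.
- by exists 0%R; rewrite ltNyr ltry.
Qed.

(** The conclusion expresses continuity at x of a nonincreasing F without
limits: F x is at most the supremum of F on the right of x, and at least the
infimum of F on the left of x.  Points where this fails are labelled
injectively by rational numbers in the jump of F. *)
Lemma nonincreasing_ae_continuous (F : R -> \bar R) :
  {homo F : x y / (x <= y)%R >-> y <= x} ->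
  {ae lebesgue_measure, forall x : R,
    (forall a, (forall y, (x < y)%R -> F y <= a) -> F x <= a) /\
    (forall a, (forall y, (y < x)%R -> a <= F y) -> a <= F x)}.
Proof.
move=> Fni.
pose jump (q : rat) := [set x : R |
  (forall y, (x < y)%R -> F y < (ratr q)%:E) /\
  (forall y, (y < x)%R -> (ratr q)%:E < F y)].
have jump1 q : is_subset1 (jump q).
  have aux x y : jump q x -> jump q y -> ~ (x < y)%R.
    move=> [xq _] [_ qy] xy; have [xm my] := midf_lt xy.
    by have := lt_trans (xq _ xm) (qy _ my); rewrite ltxx.
  move=> x y jx jy; apply/eqP; rewrite eq_le !leNgt.
  by apply/andP; split; apply/negP; exact: aux.
have cjump : countable (\bigcup_q jump q).
  apply: bigcup_countable => // q _.
  apply: finite_set_countable.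
  have [[x jx]|/forallNP j0] := pselect (exists x, jump q x).
    by apply: (@sub_finite_set _ _ [set x]) => // y jy /=; exact: (jump1 q).
  by rewrite (_ : jump q = set0)// -subset0 => x /j0.
exists (\bigcup_q jump q); split.
- exact: countable_measurable.
- exact: countable_lebesgue_measure0.
move=> x /= nx; apply: contrapT => xj; apply: nx; split => a ha.
- rewrite leNgt; apply/negP => /ereal_rat_between[q /andP[aq qF]]; apply: xj.
  exists q => //; split => y xy; first exact: le_lt_trans (ha _ xy) aq.
  by apply: lt_le_trans qF _; exact/Fni/ltW.
- rewrite leNgt; apply/negP => /ereal_rat_between[q /andP[Fq qa]]; apply: xj.
  exists q => //; split => y xy; last exact: lt_le_trans qa (ha _ xy).
  by apply: le_lt_trans Fq; exact/Fni/ltW.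
Qed.

Lemma le_limn_einf (u : (\bar R)^nat) a :
  (\forall n \near \oo, a <= u n) -> a <= limn_einf u.
Proof.
move=> [N _ au]; rewrite limn_einf_lim.
apply: lime_ge; first exact: is_cvg_einfs.
exists N => // m /= Nm; apply: le_ereal_inf_tmp => _ [k /= mk <-].
by apply: au => /=; exact: leq_trans mk.
Qed.

Lemma ge_limn_esup (u : (\bar R)^nat) a :
  (\forall n \near \oo, u n <= a) -> limn_esup u <= a.
Proof.
move=> [N _ au]; rewrite limn_esup_lim.
apply: lime_le; first exact: is_cvg_esups.
exists N => // m /= Nm; apply: ge_ereal_sup => _ [k /= mk <-].
by apply: au => /=; exact: leq_trans mk.
Qed.

Lemma einf_esup_cvg (u : (\bar R)^nat) l :
  l <= limn_einf u -> limn_esup u <= l -> u @ \oo --> l.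
Proof.
move=> lu ul.
have le : limn_einf u = l.
  by apply/le_anti; rewrite lu (le_trans (limn_einf_sup u)).
have se : limn_esup u = l.
  by apply/le_anti; rewrite ul -{1}le limn_einf_sup.
apply: (@squeeze_cvge _ _ _ _ (einfs u) u (esups u)).
- apply: nearW => n; apply/andP; split.
  + by apply: ereal_inf_lbound; exists n => /=.
  + by apply: ereal_sup_ubound; exists n => /=.
- by rewrite -le limn_einf_lim; exact: is_cvg_einfs.
- by rewrite -se limn_esup_lim; exact: is_cvg_esups.
Qed.

End ereal_monotone.

(** * Borel sets, diameters and monotonicity of the observable diameter *)

Section metric_measure.
Context {R : realType}.
Implicit Types X Y Z : pmetricType R.

Lemma closed_cball X (x : X) r : closed (cball x r).
Proof.
move=> y cy /=; apply/ler_addgt0Pr => e e0.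
have [z [xz]] := cy _ (nbhsx_ballx y e e0).
rewrite ballEmdist/= => yz; apply: le_trans (metric_triangle x z y) _.
by rewrite lerD// metric_sym ltW.
Qed.

Lemma closed_borel X (A : set X) : closed A -> measurable (A : set (borel X)).
Proof.
move=> cA; rewrite -(setCK A); apply: measurableC.
by apply: sub_sigma_algebra; exact: closed_openC.
Qed.

Lemma open_borel X (A : set X) : open A -> measurable (A : set (borel X)).
Proof. by move=> oA; exact: sub_sigma_algebra. Qed.

Lemma lip1_measurable X Y (f : X -> Y) : lip1 X Y f ->
  measurable_fun [set: borel X] (f : borel X -> borel Y).
Proof.
move=> fl; apply: (@measurability _ _ (borel X) (borel Y) setT f (@open Y))
  => //.
move=> _ [U oU <-]; rewrite setTI; apply: open_borel.
suff cf : continuous f by exact: open_comp.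
move=> x; apply/cvg_ballP => e e0; rewrite near_simpl.
apply/nbhs_ballP; exists e => // y; rewrite !ballEmdist/=.
exact: le_lt_trans (fl _ _).
Qed.

Lemma mdist_le_diam X (A : set X) x y : A x -> A y ->
  ((mdist x y)%:E <= diam A)%E.
Proof.
by move=> Ax Ay; apply: ereal_sup_ubound; right; exists x => //; exists y.
Qed.

Lemma diam_ge0 X (A : set X) : (0 <= diam A)%E.
Proof. by apply: ereal_sup_ubound; left. Qed.

Lemma diam_le X (A : set X) (d : \bar R) : (0 <= d)%E ->
  (forall x y, A x -> A y -> ((mdist x y)%:E <= d)%E) -> (diam A <= d)%E.
Proof.
by move=> d0 Ad; apply: ge_ereal_sup => _ [->//|[x Ax] [y Ay] <-]; exact: Ad.
Qed.

Lemma diam_closure X (A : set X) : diam (closure A) = diam A.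
Proof.
apply/le_anti/andP; split; apply: diam_le; try exact: diam_ge0; last first.
  by move=> x y Ax Ay; apply: mdist_le_diam; exact: subset_closure.
move=> x y cx cy; apply/lee_addgt0Pr => e e0.
have e20 : 0 < e / 2 by rewrite divr_gt0.
have [x' [Ax']] := cx _ (nbhsx_ballx x _ e20).
have [y' [Ay']] := cy _ (nbhsx_ballx y _ e20).
rewrite !ballEmdist/= => yy xx.
apply: (@le_trans _ _ ((mdist x' y')%:E + e%:E)%E); last first.
  by rewrite leeD2r// mdist_le_diam.
rewrite -EFinD lee_fin (le_trans (metric_triangle x x' y))//.
have := metric_triangle x' y' y; rewrite (metric_sym y' y); lra.
Qed.

Lemma partial_diam_le_homo Z (m : set (borel Z) -> \bar R) :
  {homo partial_diam m : a b / a <= b >-> (a <= b)%E}.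
Proof.
move=> a b ab; apply: le_ereal_inf => _ [A [mA bA] <-]; exists A => //.
by split => //; apply: le_trans bA; rewrite lee_fin.
Qed.

Lemma obs_diam_nonincreasing X (mu : probability (borel X) R) Y :
  {homo obs_diam mu Y : k l / k <= l >-> (l <= k)%E}.
Proof.
move=> k l kl; apply: ge_ereal_sup => _ [f fl <-].
apply: (@le_trans _ _ (partial_diam
  (pushforward mu (f : borel X -> borel Y)) (1 - k))).
  by apply: partial_diam_le_homo; rewrite lerD2l lerN2.
by apply: ereal_sup_ubound; exists f.
Qed.

End metric_measure.
(** * Transfer of partial diameters along almost isometric copies *)

Section transfer.
Context {R : realType} (X : pmetricType R) (mu : probability (borel X) R).
Implicit Types Y Z : pmetricType R.

(** [h] copies [f] up to [d]: it is Borel and, on a set of measure at least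
[1 - d], the distances between values of [h] and between values of [f] differ
by at most [d]. *)
Definition almost_isometric_copy Y Z (f : X -> Y) (h : X -> Z) (d : R) : Prop :=
  measurable_fun [set: borel X] (h : borel X -> borel Z) /\
  exists X' : set (borel X), [/\ measurable X', ((1 - d)%:E <= mu X')%E &
    forall s t : X, X' s -> X' t ->
      `|mdist (h s) (h t) - mdist (f s) (f t)| <= d].

Lemma copy_lip1_approx Y Z (f : X -> Y) (h : X -> Z) d :
  lip1 X Y f -> almost_isometric_copy f h d -> lip1_approx mu (Y:=Z) d h.
Proof.
move=> fl [mh [X' [mX' muX' fh]]]; split => //; exists X'.
split => // s t sX tX.
have := fh _ _ sX tX; rewrite ler_norml => /andP[_].
by have := fl s t; lra.
Qed.

(** The Ky Fan distance involves an outer measure; subadditivity of the outer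
measure is used throughout, so that the set where [g] is far from [h] need not
be measurable. *)
Lemma partial_diam_copy Y Z (f : X -> Y) (g h : X -> Z) (d e k : R) :
  0 <= d ->
  measurable_fun [set: borel X] (f : borel X -> borel Y) ->
  measurable_fun [set: borel X] (g : borel X -> borel Z) ->
  almost_isometric_copy f h d -> (ky_fan mu g h < e%:E)%E ->
  (partial_diam (pushforward mu (f : borel X -> borel Y)) (1 - (k + (e + d))) <=
   partial_diam (pushforward mu (g : borel X -> borel Z)) (1 - k) +
   (2 * e + d)%:E)%E.
Proof.
move=> d0 mf mg [mh [X' [mX' muX' fh]]].
move=> /ereal_inf_lt[_ [c [c0 muc] <-]]; rewrite lte_fin => ce.
rewrite -leeBlDr//; apply: le_ereal_inf_tmp => _ [A [mA kA] <-].
rewrite leeBlDr//.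
set far := [set z : borel X | _] in muc.
pose S := ((g : X -> Z) @^-1` A `&` X') `\` far.
(* The image of S need not be Borel; its closure is, with the same diameter. *)
pose C : set (borel Y) := closure (f @` S : set Y).
have mC : measurable C by apply: closed_borel; exact: closed_closure.
apply: (@le_trans _ _ (diam (C : set Y))).
  apply: ereal_inf_lbound; exists C => //; split => //.
  have mfC : measurable (f @^-1` C : set (borel X)).
    by rewrite -[X in measurable X]setTI; exact: mf.
  have mgA : measurable (g @^-1` A : set (borel X)).
    by rewrite -[X in measurable X]setTI; exact: mg.
  have gA : (g : borel X -> borel Z) @^-1` A `<=`
      (f @^-1` C `|` (~` X' `|` far)).
    move=> z Az; have [X'z|] := pselect (X' z); last by right; left.
    have [|nfar] := pselect (far z); first by right; right.
    by left; apply: subset_closure; exists z.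
  have muX'C : (mu (~` X') <= d%:E)%E.
    rewrite probability_setC// leeBlDr; last by rewrite fin_num_measure.
    by rewrite -leeBlDl// -EFinB.
  have : ((1 - k)%:E <= mu (f @^-1` C) + (d%:E + c%:E))%E.
    apply: (le_trans kA); rewrite /pushforward.
    rewrite -(measurable_mu_extE mu mgA).
    apply: le_trans (le_outer_measure (mu^*)%mu _ _ gA) _.
    apply: le_trans (outer_measureU2 _ _ _) _.
    apply: leeD; first by rewrite /= measurable_mu_extE.
    apply: le_trans (outer_measureU2 _ _ _) _.
    apply: leeD => //; rewrite /= measurable_mu_extE; last exact: measurableC.
    exact: muX'C.
  rewrite -EFinD -leeBlDr// -EFinB; apply: le_trans.
  by rewrite lee_fin; lra.
rewrite diam_closure; apply: diam_le.
  by rewrite adde_ge0 ?diam_ge0// lee_fin; lra.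
move=> _ _ [s [[As Xs] fs] <-] [t [[At Xt] ft] <-].
apply: (@le_trans _ _ ((mdist (g s) (g t))%:E + (2 * e + d)%:E)%E); last first.
  by rewrite leeD2r// mdist_le_diam.
rewrite -EFinD lee_fin.
move/negP: fs; rewrite -leNgt => fs; move/negP: ft; rewrite -leNgt => ft.
have := fh _ _ Xs Xt; rewrite ler_norml => /andP[+ _].
have := metric_triangle (h s) (g s) (h t).
have := metric_triangle (g s) (g t) (h t).
rewrite (metric_sym (h s) (g s)); lra.
Qed.

(** The same [d] serves all target spaces [Z] of the family and all maps [f]. *)
Lemma lipschitz_approximated_transfer (fam : set (pmetricType R)) e :
  lipschitz_approximated mu fam -> 0 < e -> exists2 d, 0 < d &
    forall Z, fam Z -> forall Y (f : X -> Y) (h : X -> Z), lip1 X Y f ->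
    almost_isometric_copy f h d -> forall k,
    (partial_diam (pushforward mu (f : borel X -> borel Y)) (1 - (k + e)) <=
     obs_diam mu Z k + e%:E)%E.
Proof.
move=> hfam e0.
(* The resulting error is at most [2 * (e / 4) + e / 4], below [e]. *)
have e40 : 0 < e / 4 by rewrite divr_gt0.
have : \forall d \near 0^'+, 0 < d /\ d <= e / 4 /\
   (ereal_sup [set hausdorff_dist (ky_fan mu (Y:=Y)) (lip1 X Y)
     (@lip1_approx R X mu Y d) | Y in fam] < (e / 4)%:E)%E.
  near=> d; split => //; split.
    by near: d; exact: nbhs_right_le.
  near: d.
  have := hfam [set x : \bar R | (x < (e / 4)%:E)%E].
  by apply; apply: open_nbhs_nbhs; split;
    [exact: open_ereal_lt_ereal|rewrite /= lte_fin].
move=> /filter_ex[d [d0 [de sd]]]; exists d => // Z famZ Y f h fl fh k.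
have /ereal_inf_lt[_ [c [c0 ca _] <-]] :
    (hausdorff_dist (ky_fan mu (Y:=Z)) (lip1 X Z)
     (@lip1_approx R X mu Z d) < (e / 4)%:E)%E.
  by apply: le_lt_trans sd; apply: ereal_sup_ubound; exists Z.
rewrite lte_fin => ce.
have [g gl gh] := ca _ (copy_lip1_approx fl fh).
apply: (@le_trans _ _ (partial_diam (pushforward mu (f : borel X -> borel Y))
    (1 - (k + (c + d))))).
  by apply: partial_diam_le_homo; lra.
apply: le_trans (partial_diam_copy k (ltW d0) _ _ fh gh) _.
- exact: lip1_measurable.
- exact: lip1_measurable.
- apply: leeD; last by rewrite lee_fin; lra.
  by apply: ereal_sup_ubound; exists g.
Unshelve. all: by end_near. Qed.

End transfer.
(** * Copies from Gromov-Hausdorff convergence *)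

Section gromov_hausdorff_copies.
Context {R : realType}.
Implicit Types X Y Z : pmetricType R.

Lemma compact_countable_net Y (e : R) : compact [set: Y] -> 0 < e ->
  exists s : nat -> Y, forall y, exists k, mdist y (s k) < e.
Proof.
move=> + e0; rewrite compact_cover => cY.
have [|y _|D _ cD] := cY Y setT (fun y => (ball y e)°).
- by move=> y _; exact: open_interior.
- by exists y => //; exact: nbhsx_ballx.
exists (nth point (enum_fset D)) => y.
have [z /= zD] := cD y I; move=> /interior_subset; rewrite ballEmdist/= => zy.
by exists (index z (enum_fset D)); rewrite nth_index// metric_sym.
Qed.

(** Each point is sent to the first point of a countable net at distance less
than [e]; the level sets are Borel, so any function whatsoever becomes Borel
after precomposition. *)
Lemma compact_quantization Y (e : R) : compact [set: Y] -> 0 < e ->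
  exists q : Y -> Y, (forall y, mdist y (q y) < e) /\
    forall Z (F : Y -> Z),
      measurable_fun [set: borel Y] (F \o q : borel Y -> borel Z).
Proof.
move=> cY e0; have [s sY] := compact_countable_net cY e0.
have ex y : exists k, mdist y (s k) < e by exact: sY.
pose N y := ex_minn (ex y).
exists (s \o N); split=> [y|Z F _ A _]; first by rewrite /= /N; case: ex_minnP.
rewrite setTI (_ : _ @^-1` A = \bigcup_(k in [set k | A (F (s k))])
  (ball (s k) e `\` \bigcup_(j in `I_k) ball (s j) e)); last first.
  apply/seteqP; split=> y /=.
    move=> Ay; exists (N y) => //; rewrite /N; case: ex_minnP => k yk kmin.
    split; first by rewrite ballEmdist/= metric_sym.
    move=> [j /= jk]; rewrite ballEmdist/= metric_sym => /kmin.
    by rewrite leqNgt jk.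
  move=> [k /= Ak []]; rewrite ballEmdist/= metric_sym => yk nj.
  suff -> : N y = k by [].
  rewrite /N; case: ex_minnP => m ym mmin.
  apply/eqP; rewrite eqn_leq mmin//= leqNgt; apply/negP => mk.
  by apply: nj; exists m => //; rewrite ballEmdist/= metric_sym.
have mball y : measurable (ball y e : set (borel Y)).
  apply: open_borel; rewrite openE => x /=; rewrite ballEmdist/= => yx.
  apply/nbhs_ballP; exists (e - mdist y x) => /=; first by rewrite subr_gt0.
  move=> z; rewrite !ballEmdist/= => xz.
  by have := metric_triangle y x z; lra.
apply: bigcup_measurable => k _; apply: measurableD => //.
by apply: bigcup_measurable.
Qed.

Lemma gh_dist_correspondence Y Z (e : R) : (gh_dist Y Z < e%:E)%E ->
  (exists F : Y -> Z, forall x y,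
     `|mdist (F x) (F y) - mdist x y| <= 2 * e) /\
  (exists G : Z -> Y, forall x y,
     `|mdist (G x) (G y) - mdist x y| <= 2 * e).
Proof.
move=> /ereal_inf_lt[_ [W [i [j [ii ij ->]]]]]
  /ereal_inf_lt[_ [c [c0 ci cj]] <-].
rewrite lte_fin => ce.
have near_isometry (A B : pmetricType R) (a : A -> W) (b : B -> W)
    (F : A -> B) :
    isometric_embedding a -> isometric_embedding b ->
    (forall x, mdist (a x) (b (F x)) < c) ->
    forall x y, `|mdist (F x) (F y) - mdist x y| <= 2 * e.
  move=> ia ib aF x y; rewrite -ia -ib ler_norml; apply/andP.
  have := aF x; have := aF y.
  have := metric_triangle (a x) (b (F x)) (a y).
  have := metric_triangle (b (F x)) (b (F y)) (a y).
  have := metric_triangle (b (F x)) (a x) (b (F y)).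
  have := metric_triangle (a x) (a y) (b (F y)).
  rewrite (metric_sym (b (F x)) (a x)) (metric_sym (b (F y)) (a y)).
  by move=> *; split; lra.
split.
- have /choice[F aF] : forall y, exists z, mdist (i y) (j z) < c.
    move=> y; have [|_ [z _ <-]] := cj (i y); first by exists y.
    by rewrite lte_fin metric_sym => ?; exists z.
  by exists F; exact: near_isometry aF.
- have /choice[F aF] : forall z, exists y, mdist (j z) (i y) < c.
    move=> z; have [|_ [y _ <-]] := ci (j z); first by exists z.
    by rewrite lte_fin metric_sym => ?; exists y.
  by exists F; exact: near_isometry aF.
Qed.

Context (X : pmetricType R) (mu : probability (borel X) R).

Lemma compact_copy Y Z (F : Y -> Z) (f : X -> Y) (d : R) :
  compact [set: Y] -> 0 < d ->
  (forall x y, `|mdist (F x) (F y) - mdist x y| <= d / 2) -> lip1 X Y f ->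
  exists h : X -> Z, almost_isometric_copy mu f h d.
Proof.
move=> cY d0 Fd fl.
have d40 : 0 < d / 4 by rewrite divr_gt0.
have [q [qY mq]] := compact_quantization cY d40.
exists (F \o q \o f); split.
  apply: (@measurableT_comp _ _ _ (borel X) (borel Y) (borel Z)).
    exact: mq.
  exact: lip1_measurable.
exists setT; split => //; first by rewrite probability_setT lee_fin; lra.
move=> s t _ _ /=; have := Fd (q (f s)) (q (f t)).
rewrite !ler_norml => /andP[].
have := qY (f s); have := qY (f t).
have := metric_triangle (f s) (q (f s)) (f t).
have := metric_triangle (q (f s)) (q (f t)) (f t).
have := metric_triangle (q (f s)) (f s) (q (f t)).
have := metric_triangle (f s) (f t) (q (f t)).
rewrite (metric_sym (q (f s)) (f s)) (metric_sym (q (f t)) (f t)).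
by move=> *; apply/andP; split; lra.
Qed.

(** How large [n] must be depends on [f], through the mass that [f] puts outside
the balls around [o]. *)
Lemma pointed_copy (Y_ : nat -> pmetricType R) (o_ : forall n, Y_ n) Y (o : Y)
    (f : X -> Y) (d : R) :
  pointed_gh_cvg o_ o -> lip1 X Y f -> 0 < d ->
  \forall n \near \oo, exists h : X -> Y_ n, almost_isometric_copy mu f h d.
Proof.
move=> [r [e [F [rnd roo _ e0 FP]]]] fl d0.
pose B n : set (borel X) := f @^-1` (cball o (r n)).
have mball n : measurable (cball o (r n) : set (borel Y)).
  by apply: closed_borel; exact: closed_cball.
have mB n : measurable (B n).
  by rewrite /B -[X in measurable X]setTI; exact: lip1_measurable.
have ndB : nondecreasing_seq B.
  move=> m n mn; apply/subsetPset => x /= /le_trans; apply; exact: rnd.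
have UB : \bigcup_n B n = setT.
  rewrite -subTset => x _; move/cvgryPge : roo => /(_ (mdist o (f x)))[n _ rn].
  by exists n => //; apply: (rn n) => /=.
have muB : \forall n \near \oo, ((1 - d)%:E < mu (B n))%E.
  have := nondecreasing_cvg_mu (mu := mu) mB ltac:(by rewrite UB) ndB.
  rewrite UB [X in _ --> X]probability_setT.
  move=> /(_ [set x : \bar R | ((1 - d)%:E < x)%E]); apply.
  apply: open_nbhs_nbhs; split; first exact: open_ereal_gt_ereal.
  by rewrite /= lte_fin; lra.
have ed : \forall n \near \oo, e n <= d.
  have /cvgr0_norm_le /(_ d d0) := e0; apply: filterS => n.
  by apply: le_trans; exact: ler_norm.
near=> n.
have [mF Fe _] := FP n.
(* The n-th map is Borel only on the ball; it is extended by a constant. *)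
pose F' y := if mdist o y <= r n then F n y else point.
exists (F' \o f); split.
  apply: (@measurableT_comp _ _ _ (borel X) (borel Y) (borel (Y_ n)));
    last first.
    exact: lip1_measurable.
  apply: (@measurable_fun_if _ _ (borel Y) (borel (Y_ n))) => //.
  - apply: (@measurable_fun_bool _ (borel Y) _ _ true).
    by rewrite setTI; exact: mball.
  - by rewrite setTI; exact: mF.
exists (B n); split => //.
  by apply/ltW; near: n.
move=> s t Bs Bt; rewrite /= /F' ifT// ifT//.
by apply: le_trans (ltW (Fe _ _ Bs Bt)) _; near: n.
Unshelve. all: by end_near. Qed.

End gromov_hausdorff_copies.

(** * Semicontinuity of the observable diameter up to a shift *)

Section semicontinuity.
Context {R : realType} (X : pmetricType R) (mu : probability (borel X) R).
Context (fam : set (pmetricType R)).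
Implicit Type Y : pmetricType R.

Lemma obs_diam_le_limn_einf (Y_ : nat -> pmetricType R) Y (k l : R) :
  lipschitz_approximated mu fam -> (forall n, fam (Y_ n)) ->
  (forall f d, lip1 X Y f -> 0 < d ->
    \forall n \near \oo, exists h : X -> Y_ n,
      almost_isometric_copy mu f h d) ->
  k < l ->
  (obs_diam mu Y l <= limn_einf (fun n => obs_diam mu (Y_ n) k))%E.
Proof.
move=> hfam famY copies kl; apply: ge_ereal_sup => _ [f fl <-].
apply/lee_addgt0Pr => e e0; rewrite -leeBlDr//; apply: le_limn_einf.
have m0 : 0 < Num.min e (l - k) by rewrite lt_min e0 subr_gt0.
have [d d0 dP] := lipschitz_approximated_transfer hfam m0.
have := copies _ _ fl d0; apply: filterS => n [h fh].
rewrite leeBlDr//.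
apply: (@le_trans _ _ (obs_diam mu (Y_ n) k + (Num.min e (l - k))%:E)%E).
  apply: le_trans (dP _ (famY n) _ _ _ fl fh k).
  apply: partial_diam_le_homo.
  have : Num.min e (l - k) <= l - k by rewrite ge_min lexx orbT.
  lra.
by rewrite leeD2l// lee_fin ge_min lexx.
Qed.

(** For the upper bound the rank must be uniform in [f], since the maps
[f : X -> Y_ n] nearly realizing the observable diameters vary with [n]. *)
Lemma limn_esup_le_obs_diam (Y_ : nat -> pmetricType R) Y (k l : R) :
  lipschitz_approximated mu fam -> fam Y ->
  (forall d, 0 < d -> \forall n \near \oo, forall f, lip1 X (Y_ n) f ->
     exists h : X -> Y, almost_isometric_copy mu f h d) ->
  k < l ->
  (limn_esup (fun n => obs_diam mu (Y_ n) l) <= obs_diam mu Y k)%E.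
Proof.
move=> hfam famY copies kl; apply/lee_addgt0Pr => e e0; apply: ge_limn_esup.
have m0 : 0 < Num.min e (l - k) by rewrite lt_min e0 subr_gt0.
have [d d0 dP] := lipschitz_approximated_transfer hfam m0.
have := copies _ d0; apply: filterS => n fh.
apply: ge_ereal_sup => _ [f fl <-]; have [h {}fh] := fh f fl.
apply: (@le_trans _ _ (obs_diam mu Y k + (Num.min e (l - k))%:E)%E).
  apply: le_trans (dP _ famY _ _ _ fl fh k).
  apply: partial_diam_le_homo.
  have : Num.min e (l - k) <= l - k by rewrite ge_min lexx orbT.
  lra.
by rewrite leeD2l// lee_fin ge_min lexx.
Qed.

End semicontinuity.

Theorem theorem1p1 (R : realType) (X : pmetricType R)
    (mu : probability (borel X) R) (fam : set (pmetricType R))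
    (hX : mm_space mu) (hfam : lipschitz_approximated mu fam) :
  (forall (Y_ : nat -> pmetricType R) (Y : pmetricType R),
      (forall n, fam (Y_ n)) -> fam Y ->
      (forall n, compact [set: Y_ n]) -> compact [set: Y] ->
      gh_cvg Y_ Y ->
      {ae lebesgue_measure, forall kappa : R, 0 < kappa < 1 ->
        obs_diam mu (Y_ n) kappa @[n --> \oo] --> obs_diam mu Y kappa}) /\
  (forall (Y_ : nat -> pmetricType R) (Y : pmetricType R)
      (o_ : forall n, Y_ n) (o : Y),
      (forall n, fam (Y_ n)) -> fam Y ->
      (forall n, ~ compact [set: Y_ n]) -> ~ compact [set: Y] ->
      (forall n, proper_space (Y_ n)) -> proper_space Y ->
      pointed_gh_cvg o_ o ->
      {ae lebesgue_measure, forall kappa : R, 0 < kappa < 1 ->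
        (obs_diam mu Y kappa <=
           limn_einf (fun n => obs_diam mu (Y_ n) kappa))%E}).
Proof.
split=> [Y_ Y famY_ famY cY_ cY YY|Y_ Y o_ o famY_ famY _ _ _ _ YY].
- have ghlt d : 0 < d -> \forall n \near \oo, (gh_dist (Y_ n) Y < d%:E)%E.
    move=> d0; apply: (YY [set x : \bar R | (x < d%:E)%E]).
    by apply: open_nbhs_nbhs; split;
    [exact: open_ereal_lt_ereal|rewrite /= lte_fin].
  have := nonincreasing_ae_continuous (@obs_diam_nonincreasing R X mu Y).
  apply: (@filterS _ _ (ae_filter_ringOfSetsType lebesgue_measure))
    => k [rk lk] _.
  apply: einf_esup_cvg.
  + apply: rk => l kl; apply: (obs_diam_le_limn_einf hfam) => // f d fl d0.
    have := ghlt (d / 4) ltac:(by rewrite divr_gt0); apply: filterS => n.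
    move=> /gh_dist_correspondence[_ [F Fd]].
    apply: (compact_copy mu (F := F)) => // x y.
    by apply: le_trans (Fd x y) _; lra.
  + apply: lk => l lk; apply: (limn_esup_le_obs_diam hfam) => // d d0.
    have := ghlt (d / 4) ltac:(by rewrite divr_gt0); apply: filterS => n.
    move=> /gh_dist_correspondence[[F Fd] _] f fl.
    apply: (compact_copy mu (F := F)) => // x y.
    by apply: le_trans (Fd x y) _; lra.
- have := nonincreasing_ae_continuous (@obs_diam_nonincreasing R X mu Y).
  apply: (@filterS _ _ (ae_filter_ringOfSetsType lebesgue_measure))
    => k [rk _] _.
  apply: rk => l kl.
  apply: (obs_diam_le_limn_einf hfam) => // f d fl d0.
  exact: pointed_copy YY fl d0.
Qed.
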